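(* Let $n$ be a positive integer and let $q$ be a prime power. Then $$|IST_n(\mathbb{F}_q)|=\beta_1 \lambda_1^n+\beta_2 \lambda_2^n,$$ where $$\beta_1=\frac{(q+1)+\sqrt{(q-1)(q+3)}}{q\left((q+3)+\sqrt{(q-1)(q+3)}\right)},\qquad \beta_2=\frac{(q+1)-\sqrt{(q-1)(q+3)}}{q\left((q+3)-\sqrt{(q-1)(q+3)}\right)},$$ $$\lambda_1=\frac{q(q-1)+q\sqrt{(q-1)(q+3)}}{2},\qquad \lambda_2=\frac{q(q-1)-q\sqrt{(q-1)(q+3)}}{2}.$$
   Context: $\mathbb{F}_q$ is the finite field with $q$ elements. For $n\ge 1$, $ST_n(\mathbb{F}_q)$ is the set of $n\times n$ symmetric tridiagonal matrices over $\mathbb{F}_q$, i.e. symmetric matrices whose entries outside the main diagonal, the subdiagonal and the superdiagonal are zero (arbitrary $1\times 1$ matrices when $n=1$). $IST_n(\mathbb{F}_q)=\{A\in ST_n(\mathbb{F}_q): \det(A)\neq 0\}$. *)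

(* Defs.v *)
From HB Require Import structures.
From mathcomp Require Import all_boot all_order all_algebra.

Set Implicit Arguments.
Unset Strict Implicit.
Unset Printing Implicit Defensive.

Import Order.TTheory GRing.Theory Num.Theory.
Local Open Scope ring_scope.

Definition tridiagonal (F : finFieldType) (n : nat) (A : 'M[F]_n) : bool :=
  [forall i : 'I_n, forall j : 'I_n,
     ((i.+1 < j) || (j.+1 < i))%N ==> (A i j == 0)].

Definition ST (F : finFieldType) (n : nat) : {set 'M[F]_n} :=
  [set A : 'M[F]_n | (A^T == A) && tridiagonal A].

Definition IST (F : finFieldType) (n : nat) : {set 'M[F]_n} :=
  [set A in ST F n | \det A != 0].

Section Constants.
Variables (R : rcfType) (q : nat).

Local Notation Q := (q%:R : R).
Local Notation s := (Num.sqrt ((Q - 1) * (Q + 3))).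

Definition beta1 : R := ((Q + 1) + s) / (Q * ((Q + 3) + s)).
Definition beta2 : R := ((Q + 1) - s) / (Q * ((Q + 3) - s)).
Definition lambda1 : R := (Q * (Q - 1) + Q * s) / 2.
Definition lambda2 : R := (Q * (Q - 1) - Q * s) / 2.

End Constants.

(* Main.v *)
(** Bordering B in ST_(n-1) by a corner entry a and an off-diagonal entry b gives
    det A = a det B - b^2 det B', where B' is B without its first row and column.
    If det B <> 0, exactly q(q-1) pairs (a, b) make A nonsingular; if det B = 0,
    A is nonsingular iff b <> 0 and det B' <> 0.  Conversely, A is singular over
    a given nonsingular B for exactly q pairs (a, b).  Hence the number N_n of
    nonsingular matrices satisfies N_n = q(q-1) N_(n-1) + q^2(q-1) N_(n-2), whose
    characteristic roots are lambda1 and lambda2. *)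

Require Import Defs.
From mathcomp Require Import all_boot all_order all_algebra.
From mathcomp Require Import ring.

Import Order.TTheory GRing.Theory Num.Theory.
Local Open Scope ring_scope.

Definition ulminor {T : Type} {n : nat} (A : 'M[T]_n.+1) : 'M[T]_n :=
  row' ord0 (col' ord0 A).

(** [B] has size at least one, so that [b] has a place: next to the first index of [B]. *)
Definition border {F : finFieldType} {n : nat} (a b : F) (B : 'M[F]_n.+1) :
    'M[F]_n.+2 :=
  \matrix_(i, j) match unlift ord0 i, unlift ord0 j with
  | None, None => a
  | None, Some k | Some k, None => if k == ord0 then b else 0
  | Some k, Some l => B k l
  end.

Section Border.
Variables (F : finFieldType) (n : nat).
Implicit Types (a b : F) (B : 'M[F]_n.+1).

Lemma border00 a b B : border a b B ord0 ord0 = a.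
Proof. by rewrite mxE unlift_none. Qed.

Lemma border0S a b B k :
  border a b B ord0 (lift ord0 k) = if k == ord0 then b else 0.
Proof. by rewrite mxE unlift_none liftK. Qed.

Lemma borderS0 a b B k :
  border a b B (lift ord0 k) ord0 = if k == ord0 then b else 0.
Proof. by rewrite mxE unlift_none liftK. Qed.

Lemma borderSS a b B k l : border a b B (lift ord0 k) (lift ord0 l) = B k l.
Proof. by rewrite mxE !liftK. Qed.

Lemma ulminor_border a b B : ulminor (border a b B) = B.
Proof. by apply/matrixP=> i j; rewrite 2!mxE borderSS. Qed.

Lemma det_border a b B :
  \det (border a b B) = a * \det B - b ^+ 2 * \det (ulminor B).
Proof.
rewrite (expand_det_row _ ord0) big_ord_recl border00 /cofactor.
rewrite -/(ulminor (border a b B)) ulminor_border addn0 expr0 mul1r; congr (_ + _).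
rewrite big_ord_recl border0S eqxx big1 => [|i _]; last by rewrite border0S mul0r.
rewrite addr0 expr1; set C := row' ord0 (col' _ _).
(* [C] omits column 1 of the bordered matrix, so its first column is the old column 0 without its
   top entry: [b] followed by zeros. *)
have lift10 : lift (lift ord0 ord0 : 'I_n.+2) ord0 = ord0 by apply: val_inj.
have C0 i : C i ord0 = if i == ord0 then b else 0.
  by rewrite 2!mxE lift10 borderS0.
rewrite (expand_det_col _ ord0) big_ord_recl big1 => [|i _]; last first.
  by rewrite C0 mul0r.
rewrite C0 eqxx /cofactor -/(ulminor C).
have -> : ulminor C = ulminor B.
  apply/matrixP=> i j; rewrite [LHS]mxE mxE 2!mxE [RHS]mxE [RHS]mxE.
  by rewrite -(borderSS a b); congr (border _ _ _ _ _); apply: val_inj.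
by ring.
Qed.

Lemma border_ST a b B : (border a b B \in ST F n.+2) = (B \in ST F n.+1).
Proof.
rewrite !inE; apply/andP/andP=> -[/eqP/matrixP sA /forallP tA]; split.
- apply/eqP/matrixP=> i j.
  by have := sA (lift ord0 i) (lift ord0 j); rewrite mxE !borderSS mxE.
- apply/forallP=> i; apply/forallP=> j.
  by have /forallP/(_ (lift ord0 j)) := tA (lift ord0 i); rewrite borderSS.
- apply/eqP/matrixP=> i j; rewrite mxE.
  case: (unliftP ord0 i) => [k ->|->]; case: (unliftP ord0 j) => [l ->|->];
    rewrite ?borderSS ?border0S ?borderS0 ?border00 //.
  by have := sA k l; rewrite mxE.
- apply/forallP=> i; apply/forallP=> j.
  case: (unliftP ord0 i) => [k ->|->]; case: (unliftP ord0 j) => [l ->|->];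
    rewrite ?borderSS ?border0S ?borderS0 ?border00 //.
  + by have /forallP/(_ l) := tA k.
  (* For [k = 0] the entry is adjacent to the diagonal and unconstrained; for larger [k] it is 0 by
     construction. *)
  + by case: k => [[|k] lk] //=; rewrite eqxx implybT.
  + by case: l => [[|l] ll] //=; rewrite eqxx implybT.
Qed.

(** Tridiagonality kills the first row beyond its second entry, and symmetry carries this over to
    the first column. *)
Lemma border_ulminor (A : 'M[F]_n.+2) : A \in ST F n.+2 ->
  border (A ord0 ord0) (A ord0 (lift ord0 ord0)) (ulminor A) = A.
Proof.
rewrite inE => /andP[/eqP/matrixP sA /forallP tA]; apply/matrixP=> i j.
have A0 k : A ord0 (lift ord0 k) =
    if k == ord0 then A ord0 (lift ord0 ord0) else 0.
  case: eqVneq => [->//|k0]; have /forallP/(_ (lift ord0 k))/implyP := tA ord0.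
  move=> tAk; apply/eqP/tAk; apply/orP; left.
  by rewrite /= /bump /= add1n ltnS lt0n.
case: (unliftP ord0 i) => [k ->|->]; case: (unliftP ord0 j) => [l ->|->];
  rewrite ?borderSS ?border0S ?borderS0 ?border00 //.
- by rewrite !mxE.
- by rewrite -A0; have := sA (lift ord0 k) ord0; rewrite mxE.
Qed.

(** Bordering is a bijection onto [ST F n.+2]. The sum over [a] is innermost because, for fixed [B]
    and [b], the determinant is affine in [a]. *)
Lemma sum_ST_border (f : 'M[F]_n.+2 -> nat) :
  (\sum_(A in ST F n.+2) f A =
   \sum_(B in ST F n.+1) \sum_b \sum_a f (border a b B))%N.
Proof.
transitivity (\sum_(B in ST F n.+1) \sum_(p : F * F) f (border p.2 p.1 B))%N.
  rewrite pair_big_dep /=.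
  rewrite (reindex_onto (fun u : 'M[F]_n.+1 * (F * F) => border u.2.2 u.2.1 u.1)
     (fun A => (ulminor A, (A ord0 (lift ord0 ord0), A ord0 ord0)))) /=; last first.
    by move=> A /border_ulminor.
  apply: eq_bigl => -[B [b a]] /=.
  by rewrite border_ST ulminor_border border0S eqxx border00 eqxx ?andbT.
by apply: eq_bigr => B _; rewrite pair_big.
Qed.

End Border.

Lemma card_affine_root {F : finFieldType} (c d : F) : c != 0 ->
  (\sum_(a : F) (a * c - d == 0)%R = 1)%N.
Proof.
move=> c0; rewrite (bigD1 (d / c)) //= divfK // subrr eqxx big1 // => a ad.
by rewrite subr_eq0; apply/eqP; rewrite eqb0; apply: contraNneq ad => <-; rewrite mulfK.
Qed.

Lemma card_affine_nonroot {F : finFieldType} (c d : F) : c != 0 ->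
  (\sum_(a : F) (a * c - d != 0)%R = #|F|.-1)%N.
Proof.
move=> c0.
have <- : (\sum_(a : F) ((a * c - d == 0)%R + (a * c - d != 0)%R) = #|F|)%N.
  by rewrite -sum1_card; apply: eq_bigr => a _; case: (_ == 0).
by rewrite big_split /= card_affine_root.
Qed.

(** These are exactly the singular matrices that still have a nonsingular bordering. *)
Definition singular_ST (F : finFieldType) (n : nat) : {set 'M[F]_n.+1} :=
  [set A in ST F n.+1 | (\det A == 0) && (\det (ulminor A) != 0)].

Lemma card_setsum (T : finType) (S : {set T}) (P : pred T) :
  #|[set x in S | P x]| = (\sum_(x in S) P x)%N.
Proof.
rewrite -sum1_card big_mkcond [RHS]big_mkcond; apply: eq_bigr => x _.
by rewrite inE; case: (x \in S); case: (P x).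
Qed.

Lemma card_ISTSS (F : finFieldType) (n : nat) :
  #|IST F n.+2| =
    (#|F| * #|F|.-1 * (#|IST F n.+1| + #|singular_ST F n|))%N.
Proof.
rewrite /IST /singular_ST !card_setsum sum_ST_border -big_split big_distrr /=.
apply: eq_bigr => B _; have [B0|B0] /= := eqVneq (\det B) 0; last first.
  rewrite addn0 muln1 -sum_nat_const; apply: eq_bigr => b _.
  by under eq_bigr do rewrite det_border; rewrite card_affine_nonroot.
have [B'0|B'0] /= := eqVneq (\det (ulminor B)) 0.
  rewrite addn0 muln0 big1 // => b _; rewrite big1 // => a _.
  by rewrite det_border B0 B'0 !mulr0 subrr eqxx.
(* Here the determinant is [- b ^+ 2 * \det (ulminor B)]: [a] is free and [b] must be nonzero. The
   nonzero [b] are counted as nonroots of [b * 1 - 0]. *)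
rewrite add0n muln1 mulnC -(card_affine_nonroot (1 : F) 0 (oner_neq0 _)) big_distrl /=.
apply: eq_bigr => b _; rewrite mulnC -sum_nat_const; apply: eq_bigr => a _.
rewrite det_border B0 mulr0 sub0r oppr_eq0 mulf_eq0 (negPf B'0) orbF expf_eq0 /=.
by rewrite mulr1 subr0.
Qed.

(** Over a nonsingular [B], each [b] admits exactly one [a] that makes the determinant vanish. *)
Lemma card_singular_STS (F : finFieldType) (n : nat) :
  #|singular_ST F n.+1| = (#|F| * #|IST F n.+1|)%N.
Proof.
rewrite /IST /singular_ST !card_setsum sum_ST_border big_distrr /=.
apply: eq_bigr => B _.
under eq_bigr do under eq_bigr do rewrite det_border ulminor_border.
have [B0|B0] /= := eqVneq (\det B) 0.
  by rewrite muln0 big1 // => b _; rewrite big1 // => a _; rewrite andbF.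
rewrite muln1 -[RHS]muln1 -sum_nat_const; apply: eq_bigr => b _.
by under eq_bigr do rewrite andbT; rewrite card_affine_root.
Qed.

Lemma sum_ST1 (F : finFieldType) (f : 'M[F]_1 -> nat) :
  (\sum_(A in ST F 1) f A = \sum_a f a%:M)%N.
Proof.
rewrite (reindex_onto (fun a : F => a%:M : 'M_1) (fun A => A ord0 ord0)) /=; last first.
  by move=> A _; rewrite -mx11_scalar.
apply: eq_bigl => a; rewrite inE tr_scalar_mx !mxE !eqxx ?andbT.
by apply/forallP=> i; apply/forallP=> j; rewrite !ord1.
Qed.

Lemma card_IST1 (F : finFieldType) : #|IST F 1| = #|F|.-1.
Proof.
rewrite /IST card_setsum sum_ST1 -(card_affine_nonroot (1 : F) 0 (oner_neq0 _)).
by apply: eq_bigr => a _; rewrite det_scalar1 mulr1 subr0.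
Qed.

(** Only the zero matrix counts: its minor is the empty matrix, of determinant 1. *)
Lemma card_singular_ST0 (F : finFieldType) : #|singular_ST F 0| = 1%N.
Proof.
rewrite /singular_ST card_setsum sum_ST1; apply: etrans (card_affine_root (1 : F) 0 (oner_neq0 _)).
by apply: eq_bigr => a _; rewrite det_scalar1 det_mx00 oner_eq0 andbT mulr1 subr0.
Qed.

Section Constants.
Variables (R : rcfType) (q : nat).
Hypothesis q_gt0 : (0 < q)%N.
Local Notation Q := (q%:R : R).
Local Notation s := (Num.sqrt ((Q - 1) * (Q + 3))).

Let Q_ge1 : 1 <= Q. Proof. by rewrite ler1n. Qed.

Let s2 : s ^+ 2 = (Q - 1) * (Q + 3).
Proof. by rewrite sqr_sqrtr // mulr_ge0 ?subr_ge0 // addr_ge0 ?ler0n. Qed.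

Lemma lambda1_sqr :
  lambda1 R q ^+ 2 = Q * (Q - 1) * lambda1 R q + Q ^+ 2 * (Q - 1).
Proof. by rewrite /lambda1; field: s2. Qed.

Lemma lambda2_sqr :
  lambda2 R q ^+ 2 = Q * (Q - 1) * lambda2 R q + Q ^+ 2 * (Q - 1).
Proof. by rewrite /lambda2; field: s2. Qed.

Let Q_neq0 : Q != 0. Proof. by rewrite pnatr_eq0 -lt0n. Qed.

(** The product of the conjugate denominators is free of [s] and positive, so neither of them
    vanishes. *)
Let denominators : (Q + 3 + s) * (Q + 3 - s) = 4 * (Q + 3).
Proof. by ring: s2. Qed.

Let denominators_neq0 : (Q + 3 + s != 0) && (Q + 3 - s != 0).
Proof.
rewrite -negb_or -mulf_eq0 denominators mulf_neq0 ?pnatr_eq0 //.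
by rewrite -natrD pnatr_eq0 addn_eq0 andbF.
Qed.

(** The closed form at exponent 0 is 1/q; multiplied by q it matches the single element of
    [singular_ST F 0]. *)
Lemma beta_sum : beta1 R q + beta2 R q = Q^-1.
Proof.
have /andP[dp dm] := denominators_neq0; rewrite /beta1 /beta2.
by field: s2; rewrite dp dm Q_neq0.
Qed.

Lemma beta_lambda_sum :
  beta1 R q * lambda1 R q + beta2 R q * lambda2 R q = Q - 1.
Proof.
have /andP[dp dm] := denominators_neq0.
rewrite /beta1 /beta2 /lambda1 /lambda2.
by field: s2; rewrite dp dm Q_neq0.
Qed.

End Constants.

Theorem theorem2p2 (R : rcfType) (F : finFieldType) (q : nat) (hq : #|F| = q)
    (n : nat) (hn : (0 < n)%N) :
  (#|IST F n|)%:R =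
    beta1 R q * lambda1 R q ^+ n + beta2 R q * lambda2 R q ^+ n.
Proof.
have q_gt0 : (0 < q)%N by rewrite -hq; apply/card_gt0P; exists 0.
have Q1 : (q.-1)%:R = q%:R - 1 :> R by rewrite -subn1 natrB.
case: n hn => // n _.
(* Carrying both counts turns the second-order recurrence into a plain induction. *)
suff [] : (#|IST F n.+1|)%:R =
      beta1 R q * lambda1 R q ^+ n.+1 + beta2 R q * lambda2 R q ^+ n.+1 /\
    (#|singular_ST F n|)%:R =
      q%:R * (beta1 R q * lambda1 R q ^+ n + beta2 R q * lambda2 R q ^+ n) by [].
elim: n => [|n [IHI IHS]].
  rewrite card_IST1 card_singular_ST0 hq Q1 !expr1 !expr0 !mulr1.
  by rewrite beta_lambda_sum // beta_sum // divff // pnatr_eq0 -lt0n.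
rewrite card_ISTSS card_singular_STS hq !natrM natrD IHI IHS Q1; split=> //.
(* What remains is the sum of the two characteristic equations, weighted by [beta1 * lambda1 ^+ n]
   and [beta2 * lambda2 ^+ n]. *)
have := lambda1_sqr R q q_gt0; have := lambda2_sqr R q q_gt0.
rewrite !exprS => l2 l1; ring: l1 l2.
Qed.
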